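(* Let $K$ be a field and let $n\ge 1$. Let $\vartheta\in\{\text{left},\text{right},\text{pre-two-sided},\text{two-sided}\}$ and let $\mathcal M$ be a proper $\vartheta$-Mathieu subspace of $\operatorname{Mat}_n(K)$ whose codimension in $\operatorname{Mat}_n(K)$ is less than $\min\{n,\#K\}$. Then $\operatorname{tr} M=0$ for all $M\in\mathcal M$. In particular, if $\operatorname{char}K=0$ or $\operatorname{char}K\ge n$, then every element of $\mathfrak r(\mathcal M)$ is nilpotent and $\mathcal M$ is a two-sided Mathieu subspace of $\operatorname{Mat}_n(K)$.
   Context: $\operatorname{Mat}_n(K)$ is the $K$-algebra of $n\times n$ matrices over $K$; $\#K$ is the cardinality of $K$. A $K$-subspace $\mathcal M$ of an associative $K$-algebra $\mathcal A$ is called a $\vartheta$-Mathieu subspace of $\mathcal A$ if for all $a,b,c\in\mathcal A$ such that $a^m\in\mathcal M$ for all $m\ge 1$, the following holds: $ba^m\in\mathcal M$ for all sufficiently large $m$ (if $\vartheta$ = left); $a^mc\in\mathcal M$ for all sufficiently large $m$ (if $\vartheta$ = right); $ba^m\in\mathcal M$ and $a^mc\in\mathcal M$ for all sufficiently large $m$ (if $\vartheta$ = pre-two-sided); $ba^mc\in\mathcal M$ for all sufficiently large $m$ (if $\vartheta$ = two-sided). For a subset $S\subseteq\mathcal A$, the radical is $\mathfrak r(S)=\{a\in\mathcal A\mid a^m\in S\text{ for all sufficiently large } m\}$. A Mathieu subspace is proper if it is not all of $\operatorname{Mat}_n(K)$. *)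

(* Defs.v *)
From HB Require Import structures.
From mathcomp Require Import all_boot all_order all_algebra all_field.
From mathcomp Require Import boolp classical_sets cardinality filter.

Set Implicit Arguments.
Unset Strict Implicit.
Unset Printing Implicit Defensive.

Import GRing.Theory.
Local Open Scope classical_set_scope.
Local Open Scope card_scope.
Local Open Scope ring_scope.

Variant mathieu_side := LeftM | RightM | PreTwoSidedM | TwoSidedM.

Section Mathieu.
Variables (K : fieldType) (A : algType K).

Definition mathieu_absorbs (side : mathieu_side) (M : {pred A}) (a b c : A) :
    Prop :=
  match side with
  | LeftM => \forall m \near \oo, b * a ^+ m \in M
  | RightM => \forall m \near \oo, a ^+ m * c \in M
  | PreTwoSidedM =>
      \forall m \near \oo, b * a ^+ m \in M /\ a ^+ m * c \in M
  | TwoSidedM => \forall m \near \oo, b * a ^+ m * c \in M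
  end.

Definition mathieu_subspace (side : mathieu_side) (M : {pred A}) : Prop :=
  GRing.submod_closed M /\
  forall a b c : A, (forall m : nat, (1 <= m)%N -> a ^+ m \in M) ->
    mathieu_absorbs side M a b c.

Definition radical (S : {pred A}) : set A :=
  [set a | \forall m \near \oo, a ^+ m \in S].

Definition nilpotent_elt (a : A) : Prop := exists m : nat, a ^+ m = 0.

End Mathieu.

Definition codimv (K : fieldType) (V : vectType K) (U : {vspace V}) : nat :=
  (\dim {:V} - \dim U)%N.

(* Strict comparison of a natural number with a possibly infinite cardinal:
   #T is not at most c. *)
Definition lt_card (c : nat) (T : Type) : Prop := ~ ([set: T] #<= `I_c).

(* Main.v *)
(* For the trace form, [M] is the orthogonal of matrices [C_1, ..., C_k], with
   [k < N] for matrices of size [N]. Suppose [tr X <> 0] for some [X] in [M],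
   so that [1] is not in the span of the [C_i]. Let [W] be the span of
   [C_0 = 1, C_1, ..., C_k]. An idempotent with row space [U] can be found in
   [M] unless some combination of [C_1, ..., C_k] stabilizes [U] with nonzero
   trace on [U]; the Mathieu property forbids such idempotents. Take [x] with
   [x W] of maximal dimension. As [#K > k], an element of [W] killing [x] maps
   everything into [x W] (Amitsur), and a dimension count gives [U] containing
   [x] whose only stabilizers in [W] are the [a + b x], with [b] a column such
   that [x b = 0]. Hence the span of [C_1, ..., C_k] contains some [1 + b x].
   Doing this for a basis [x_j] of such vectors forces [k = N - 1] and a
   relation [sum_j y_j b_j x_j = 1], contradicting [x_j b_j = 0].

   For the last part, a non-nilpotent element of the radical yields a nonzero
   idempotent of [M], whose rank vanishes in [K]; this forces it to be [1]. *)
Require Import Defs.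
From HB Require Import structures.
From mathcomp Require Import all_boot all_order all_algebra all_field.
From mathcomp Require Import boolp classical_sets cardinality filter.
From mathcomp Require Import zify ring.

Set Implicit Arguments.
Unset Strict Implicit.
Unset Printing Implicit Defensive.

Import GRing.Theory.
Local Open Scope ring_scope.

(** * Ranks in pencils [t *: A + B] *)

Lemma row_free_kernel (K : fieldType) (m n : nat) (A : 'M[K]_(m, n)) :
  (forall y : 'rV_m, y *m A = 0 -> y = 0) -> row_free A.
Proof.
move=> ker0; rewrite -kermx_eq0; apply/eqP/row_matrixP => i.
by rewrite row0; apply: ker0; rewrite -row_mul mulmx_ker row0.
Qed.

(** [t%:M + D] is singular exactly when [t] is a root of the characteristic polynomial of [- D],
    which has at most [s] roots. *)
Lemma row_free_shift (K : fieldType) (rs : seq K) (s : nat) (D : 'M[K]_s) :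
  uniq rs -> (s < size rs)%N -> exists t, row_free (t%:M + D).
Proof.
move=> rs_uniq s_lt.
have [/hasP[t _ free_t]|] := boolP (has (fun t => row_free (t%:M + D)) rs).
  by exists t.
rewrite -all_predC => /allP no_t.
suff /max_poly_roots: all (root (char_poly (- D))) rs.
  move/(_ (monic_neq0 (char_poly_monic _)) rs_uniq).
  by rewrite size_char_poly ltnS leqNgt s_lt.
apply/allP => t /no_t /=; rewrite -eigenvalue_root_char /eigenvalue /eigenspace.
apply: contra => /eqP ker0; apply: row_free_kernel => y.
rewrite mulmxDr mul_mx_scalar => yD; apply/eqP; rewrite -submx0 -ker0.
by apply/sub_kermxP; rewrite mulmxBr mul_mx_scalar mulmxN -opprD addrC yD oppr0.
Qed.

(** With [P *m A *m R = 1] of size [\rank A], the pencil compresses to [t%:M + P *m B *m R], which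
    is invertible for some [t]. *)
Lemma pencil_rank (K : fieldType) (rs : seq K) (m n : nat) (A B : 'M[K]_(m, n))
  :
  uniq rs -> (\rank A < size rs)%N ->
  exists t, (\rank A <= \rank (t *: A + B)%R)%N.
Proof.
move=> rs_uniq lt_rs.
have /submxP[P defP] : (row_base A <= A)%MS by rewrite eq_row_base.
have /row_freeP[R AR1] := row_base_free A.
have [t free_t] := row_free_shift (P *m B *m R) rs_uniq lt_rs; exists t.
move/eqP: free_t => {1}<-; rewrite -scalemx1 -AR1 defP scalemxAl -mulmxDl.
rewrite scalemxAr -mulmxDr.
by apply: leq_trans (mxrankM_maxl _ _) (mxrankM_maxr _ _).
Qed.

Lemma nsub_separate (K : fieldType) (m n : nat) (A : 'M[K]_(m, n)) (v : 'rV_n) :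
  ~~ (v <= A)%MS -> exists2 c : 'cV_n, A *m c = 0 & v *m c = 1.
Proof.
rewrite submxE => /rV0Pn[i]; set a := _ 0 i => a0.
exists (a^-1 *: col i (cokermx A)).
  by rewrite -scalemxAr colE mulmxA mulmx_coker mul0mx scaler0.
rewrite -scalemxAr colE mulmxA -colE; apply/matrixP => p q;
  rewrite !ord1 mxE [X in _ * X]mxE.
by rewrite -/a mulVf// mxE eqxx.
Qed.

(* If [w *m B] were not in the row space of [A], adjoining it to [s = \rank A]
   suitable rows of [t *: A + B] would give [s + 1] rows, free for all but [s]
   values of [t]. *)
Lemma pencil_kernel (K : fieldType) (rs : seq K) (m n : nat)
    (A B : 'M[K]_(m, n)) (w : 'rV_m) :
  uniq rs -> (\rank A < size rs)%N ->
  (forall t, (\rank (t *: A + B)%R <= \rank A)%N) ->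
  w *m A = 0 -> (w *m B <= A)%MS.
Proof.
move=> rs_uniq lt_rs le_rank wA0; apply: contraT => /nsub_separate[c Ac0 wBc1].
have /submxP[P defP] : (row_base A <= A)%MS by rewrite eq_row_base.
have /row_freeP[R PAR1] := row_base_free A.
(* Eliminating the row [w *m B] of [G] by means of [c], then multiplying by [R], leaves
   [t%:M + D]. *)
pose D := P *m B *m R - (P *m B *m c) *m (w *m B *m R).
have [t free_t] := row_free_shift D rs_uniq lt_rs.
have PtR : P *m (t *: A + B) *m R = t%:M + P *m B *m R.
  by rewrite mulmxDr -scalemxAr -defP mulmxDl -scalemxAl PAR1 scalemx1.
pose G := col_mx (P *m (t *: A + B)) (w *m B).
suff freeG : row_free G.
  suff /mxrankS/leq_trans/(_ (le_rank t)) : (G <= (t *: A + B)%R)%MS.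
    by move: freeG; rewrite /row_free => /eqP->; rewrite addn1 ltnn.
  rewrite col_mx_sub submxMl /=.
  by rewrite -[w *m B]add0r -(scaler0 _ t) -wA0 scalemxAr -mulmxDr submxMl.
apply: row_free_kernel => y; rewrite -[y]hsubmxK mul_row_col.
move: (lsubmx y) (rsubmx y) => y1 a yG.
have aE : a = - (y1 *m (P *m B *m c)).
  move/(congr1 (mulmx^~ c)): yG; rewrite mul0mx mulmxDl -!mulmxA mulmxDl.
  rewrite -scalemxAl Ac0 scaler0 add0r [w *m _]mulmxA wBc1 mulmx1.
  by move/eqP; rewrite addrC addr_eq0 => /eqP.
have y10 : y1 = 0.
  apply/eqP; rewrite -(mulmx_free_eq0 _ free_t); apply/eqP.
  move/(congr1 (mulmx^~ R)): yG; rewrite mul0mx => <-.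
  rewrite aE mulmxDl -[y1 *m _ *m R]mulmxA PtR /D !(mulmxDr, mulmxBr) mulNmx.
  by rewrite mulNmx mulmxN !mulmxA addrA.
by rewrite aE y10 mul0mx oppr0 row_mx0.
Qed.

(** * Common complements *)

Lemma cap_rV_eq0 (K : fieldType) (n m : nat) (A : 'M[K]_(m, n)) (v : 'rV_n) :
  ~~ (v <= A)%MS -> (A :&: v)%MS = 0.
Proof.
move=> vA; apply/eqP/rowV0P => u; rewrite sub_capmx => /andP[uA /sub_rVP[a ua]].
have [a0|a0] := eqVneq a 0; first by rewrite ua a0 scale0r.
by case/negP: vA; rewrite -[v](scalerK a0) -ua scalemx_sub.
Qed.

(** Induction on the codimension of [B]: two proper subspaces do not cover the space, so some [v]
    lies outside both; adjoin it to [A] and [B], and afterwards to [U]. *)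
Lemma common_complement (K : fieldType) (n m1 m2 : nat)
    (A : 'M[K]_(m1, n)) (B : 'M[K]_(m2, n)) :
  (\rank A <= \rank B)%N ->
  exists U : 'M[K]_n, (U :&: A)%MS = 0 /\ (1%:M <= U + B)%MS.
Proof.
have [d] := ubnP (n - \rank B).
elim: d m1 m2 A B => // d IHd m1 m2 A B; rewrite ltnS => lt_d le_AB.
have [fullB|nfullB] := boolP (row_full B).
  by exists 0; rewrite cap0mx; split=> //; rewrite adds0mx sub1mx.
have nfullA : ~~ row_full A.
  by apply: contra nfullB; rewrite -!col_leq_rank => /leq_trans; apply.
have nfull_ex m (C : 'M[K]_(m, n)) : ~~ row_full C -> exists v : 'rV_n, ~~ (v
  <= C)%MS.
  by rewrite -sub1mx => /row_subPn[i iC]; exists (row i 1%:M).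
have [v vA vB] : exists2 v : 'rV_n, ~~ (v <= A)%MS & ~~ (v <= B)%MS.
  have [a aA] := nfull_ex _ _ nfullA; have [b bB] := nfull_ex _ _ nfullB.
  have [aB|] := boolP (a <= B)%MS; last by exists a.
  have [bA|] := boolP (b <= A)%MS; last by exists b.
  exists (a + b).
    apply: contra aA => abA; rewrite -(addrK b a) addmx_sub// -scaleN1r.
    exact: scalemx_sub.
  apply: contra bB => abB; rewrite -(addKr a b) addmx_sub// -scaleN1r.
  exact: scalemx_sub.
have v0 : v != 0 by apply: contra vA => /eqP->; rewrite sub0mx.
have rank1 m (C : 'M[K]_(m, n)) : ~~ (v <= C)%MS -> \rank (C + v)%MS = (\rank
  C).+1.
  by move=> vC; rewrite mxrank_disjoint_sum ?cap_rV_eq0// rank_rV v0 addn1.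
have [||U [capU addU]] := IHd _ _ (A + v)%MS (B + v)%MS.
- rewrite rank1//; have := rank_leq_col B; rewrite -ltnS -(rank1 _ B vB).
  have := rank_leq_col (B + v)%MS; rewrite rank1//; lia.
- by rewrite !rank1.
exists (U + v)%MS; split; last by rewrite -addsmxA (addsmxC v).
apply/eqP/rowV0P => u; rewrite sub_capmx => /andP[/sub_addsmxP[[c e] /= uE] uA].
have : (c *m U <= U :&: (A + v))%MS.
  rewrite sub_capmx submxMl /= -(addrK (e *m v) (c *m U)) -uE addmx_sub//.
    exact: submx_trans uA (addsmxSl _ _).
  by rewrite -mulNmx (submx_trans (submxMl _ _)) ?addsmxSr.
rewrite capU submx0 => /eqP cU0; move: uE; rewrite cU0 add0r => uE.
apply/eqP; rewrite -submx0 -(cap_rV_eq0 vA) sub_capmx uA uE submxMl.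
by [].
Qed.

(** * The trace form and linear systems *)

Lemma mxvec_dot (K : fieldType) (m n : nat) (A B : 'M[K]_(m, n)) :
  mxvec A *m (mxvec B)^T = (\tr (A *m B^T))%:M.
Proof.
rewrite [LHS]mx11_scalar; congr _%:M; rewrite !mxE.
rewrite (reindex _ (curry_mxvec_bij _ _)) /=.
rewrite /mxtrace; under [RHS]eq_bigr do rewrite mxE.
by rewrite pair_bigA; apply: eq_bigr => -[i j] _; rewrite /= !mxE !mxvecE.
Qed.

Lemma mxtrace_mull_inj (K : fieldType) (m n : nat) (A B : 'M[K]_(m, n)) :
  (forall D, \tr (D *m A) = \tr (D *m B)) -> A = B.
Proof.
move=> eqAB; apply/matrixP => i j;
  have := eqAB (delta_mx j (0 : 'I_1) *m delta_mx 0 i).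
rewrite -!(mulmxA (delta_mx j (0 : 'I_1))) !(mxtrace_mulC (delta_mx j _)).
by rewrite -!rowE -!colE /mxtrace !big_ord1 !mxE.
Qed.

(** Fredholm alternative: the system is solvable once every linear relation between the rows of [A]
    and [B] also holds for the right-hand side. *)
Lemma linear_system_solvable (K : fieldType) (m p q : nat)
    (A : 'M[K]_(m, q)) (B : 'M[K]_(p, q)) (d : 'cV_m) :
  (forall y z, y *m A = z *m B -> y *m d = 0 :> 'M_1) ->
  exists2 c, A *m c = d & B *m c = 0.
Proof.
move=> compat; pose G := col_mx A B; pose g := col_mx d (0 : 'cV_p).
suff /submxP[c gc] : (g^T <= G^T)%MS.
  move/(congr1 trmx): gc; rewrite trmx_mul !trmxK mul_col_mx.
  by case/eq_col_mx => dE BE; exists c^T.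
rewrite submxE -[cokermx _]trmxK -trmx_mul -trmx0 (inj_eq trmx_inj).
apply/eqP/row_matrixP => i; rewrite row_mul row0.
have : row i (cokermx G^T)^T *m G = 0.
  by rewrite -row_mul -(trmxK (_ *m G)) trmx_mul trmxK mulmx_coker trmx0 row0.
rewrite -[row i _]hsubmxK !mul_row_col mulmx0 addr0.
by move/eqP; rewrite addr_eq0 -mulNmx => /eqP/compat.
Qed.

(** * Spans of matrices and idempotents orthogonal to them *)

Section LinearCombinations.
Variables (K : fieldType) (N k : nat) (C : 'I_k -> 'M[K]_N).

Definition lin_comb (w : 'rV_k) : 'M_N := \sum_i w 0 i *: C i.

(** For [W] the span of the [C i], the row space is [x W]; the left kernel gives the combinations
    that kill [x]. *)
Definition orbit_mx (x : 'rV_N) : 'M_(k, N) := \matrix_i (x *m C i).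

Fact lin_comb_is_linear : linear lin_comb.
Proof.
move=> a u v; rewrite /lin_comb scaler_sumr -big_split; apply: eq_bigr => i _.
by rewrite !mxE scalerDl scalerA.
Qed.
HB.instance Definition _ :=
  GRing.isLinear.Build K 'rV[K]_k 'M[K]_N _ lin_comb lin_comb_is_linear.

Lemma lin_comb_delta (i : 'I_k) : lin_comb (delta_mx 0 i) = C i.
Proof.
rewrite /lin_comb (bigD1 i)//= big1 => [|j ji]; last first.
  by rewrite mxE (negPf ji) andbF scale0r.
by rewrite mxE !eqxx scale1r addr0.
Qed.

Fact orbit_mx_is_linear : linear orbit_mx.
Proof.
by move=> a u v; apply/row_matrixP => i;
  rewrite rowK mulmxDl -scalemxAl linearP /= !rowK.
Qed.
HB.instance Definition _ :=
  GRing.isLinear.Build K 'rV[K]_N 'M[K]_(k, N) _ orbit_mx orbit_mx_is_linear.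

Lemma mul_orbit_mx (w : 'rV_k) (x : 'rV_N) : w *m orbit_mx x = x *m lin_comb w.
Proof.
rewrite mulmx_sum_row /lin_comb mulmx_sumr; apply: eq_bigr => i _.
by rewrite rowK scalemxAr.
Qed.

(* The idempotent [R *m U] projects onto the row space of [U]; by duality it
   can be chosen orthogonal to all [C i] for the trace form as soon as every
   combination of the [C i] stabilizing [U] is traceless on [U]. *)
Lemma orthogonal_projection (r : nat) (U : 'M[K]_(r, N)) :
  row_free U ->
  (forall (w : 'rV_k) (D : 'M_r), U *m lin_comb w = D *m U -> \tr D = 0) ->
  exists2 R, U *m R = 1%:M & forall i, \tr (R *m U *m C i) = 0.
Proof.
move=> freeU traceless.
(* In the unknown [c = (mxvec R^T)^T], [A] encodes [U *m R = 1] through the trace form and [B] the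
   trace conditions. *)
pose A := lin_mx (mulmxr U) : 'M_(r * r, r * N).
pose B := \matrix_(i < k) mxvec (U *m C i).
have [|c Ac Bc] := @linear_system_solvable _ _ _ _ A B (mxvec (1%:M :
  'M[K]_r))^T.
  move=> y z; rewrite -[y]vec_mxK mul_vec_lin /= => yz.
  rewrite mxvec_dot trmx1 mulmx1 (traceless z) ?raddf0//;
    apply: (can_inj mxvecK).
  rewrite yz mulmx_sum_row /lin_comb mulmx_sumr linear_sum;
    apply: eq_bigr => i _.
  by rewrite rowK -scalemxAr linearZ.
pose R := (vec_mx c^T)^T;
  have cE : c = (mxvec R^T)^T by rewrite trmxK vec_mxK trmxK.
exists R; last first.
  move=> i; move: (congr1 (row i) Bc); rewrite row_mul rowK row0 cE mxvec_dot.
  move/(congr1 mxtrace); rewrite mxtrace_scalar raddf0 trmxK => trC.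
  by rewrite -mulmxA mxtrace_mulC.
apply: mxtrace_mull_inj => D; move: (congr1 (mulmx (mxvec D)) Ac).
rewrite mulmxA mul_vec_lin /= cE !mxvec_dot trmx1 mulmx1 trmxK mulmxA.
by move/(congr1 mxtrace); rewrite !mxtrace_scalar.
Qed.
End LinearCombinations.

Lemma bounded_max (T : Type) (f : T -> nat) (b : nat) (x0 : T) :
  (forall x, (f x <= b)%N) -> exists x, forall y, (f y <= f x)%N.
Proof.
move=> fb; have ex_f : exists m, `[< exists x, f x = m >].
  by exists (f x0); apply/asboolP; exists x0.
have ub m : `[< exists x, f x = m >] -> (m <= b)%N by move=> /asboolP[x <-].
case: (ex_maxnP ex_f ub) => _ /asboolP[x <-] max_x; exists x => y.
by apply: max_x; apply/asboolP; exists y.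
Qed.

Lemma col_mul0 (K : fieldType) (m n : nat) (A : 'M[K]_(m, n)) :
  (forall c : 'cV_n, A *m c = 0) -> A = 0.
Proof.
move=> A0; rewrite -[A]mulmx1; apply/matrixP => i j; have := A0 (delta_mx j 0).
by rewrite -colE mulmx1 => /colP/(_ i); rewrite !mxE.
Qed.

(** * Generic vectors and their stable subspaces *)

Section Generic.
Variables (K : fieldType) (rs : seq K) (N k : nat) (C : 'I_k.+1 -> 'M[K]_N).
Hypotheses (rs_uniq : uniq rs) (k_lt_rs : (k < size rs)%N) (k_lt_N : (k < N)%N).
Hypothesis C0 : C ord0 = 1%:M.

Definition generic (x : 'rV_N) :=
  forall y, (\rank (orbit_mx C y) <= \rank (orbit_mx C x))%N.

Lemma exists_generic : exists x, generic x.
Proof. exact: (bounded_max 0 (fun x => rank_leq_row (orbit_mx C x))). Qed.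

Lemma sub_orbit_mx x : (x <= orbit_mx C x)%MS.
Proof.
have {1}-> : x = row ord0 (orbit_mx C x) by rewrite rowK C0 mulmx1.
exact: row_sub.
Qed.

Lemma rank_orbit_gt0 x : x != 0 -> (0 < \rank (orbit_mx C x))%N.
Proof.
move=> x0; apply: leq_trans (mxrankS (sub_orbit_mx x)).
by rewrite rank_rV x0.
Qed.

Lemma generic_neq0 x : generic x -> x != 0.
Proof.
move=> /(_ (const_mx 1)); apply: contraTneq => ->;
  rewrite linear0 mxrank0 -ltnNge.
apply: rank_orbit_gt0; apply/eqP => /rowP/(_ (Ordinal k_lt_N)).
by rewrite !mxE => /eqP; rewrite oner_eq0.
Qed.

Lemma generic_kernel x w (y : 'rV_N) :
  generic x -> x *m lin_comb C w = 0 -> (y *m lin_comb C w <= orbit_mx C x)%MS.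
Proof.
move=> gx; rewrite -!mul_orbit_mx => wx0.
(* Either [w = 0], or the orbit has rank at most [k], so that more than [k] scalars suffice for
   [k.+1] generators. *)
have [freeO|nfreeO] := boolP (row_free (orbit_mx C x)).
  move/eqP: wx0; rewrite mulmx_free_eq0// => /eqP->.
  by rewrite mul0mx sub0mx.
apply: (pencil_kernel rs_uniq _ _ wx0) => [|t];
  last by rewrite -[_ + _]linearP; apply: gx.
by apply: leq_trans k_lt_rs; rewrite ltn_neqAle nfreeO rank_leq_row.
Qed.

(* With [V = x W], the columns [Z *m q] are the functionals killing [x]. For a
   generic such [p], [G] is the common kernel of the functionals [C p], where
   [C] in [W] kills [x]. A common complement [U0] of [V] and [G] makes
   [U = x + U0] work: if [C] maps [U] into the line of [x], then [C p] vanishes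
   on [U] and [G], so [C p = 0]; genericity of [p] then gives [G C <= x]. *)
Lemma generic_stable_subspace x : generic x ->
  exists2 U : 'M_N, (x <= U)%MS &
    forall w, (U *m lin_comb C w <= U)%MS ->
      exists a b, lin_comb C w = a%:M + b *m x /\ x *m b = 0.
Proof.
move=> gx; have x0 := generic_neq0 gx; pose V := orbit_mx C x.
have V_gt0 : (0 < \rank V)%N by rewrite rank_orbit_gt0.
pose Z := cokermx x.
pose B (q : 'cV_N) := kermx V *m \matrix_i (C i *m Z *m q)^T.
have BE (z : 'rV_k.+1) q : z *m B q = (lin_comb C (z *m kermx V) *m Z *m q)^T.
  rewrite mulmxA mulmx_sum_row /lin_comb !mulmx_suml linear_sum.
  by apply: eq_bigr => i _; rewrite rowK -!scalemxAl linearZ.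
have [q max_q] : exists q, forall q', (\rank (B q') <= \rank (B q))%N.
  exact: (bounded_max 0 (fun q => rank_leq_row (B q))).
have rkB : (\rank (B q) <= k.+1 - \rank V)%N.
  by rewrite -mxrank_ker mxrankM_maxl.
pose G := kermx (B q)^T.
(* [\rank V <= N - \rank (B q)], as [\rank (B q) <= k.+1 - \rank V] and [k < N]. *)
have [|U0 [capU0 addU0]] := @common_complement _ _ _ _ V G.
  by rewrite mxrank_ker mxrank_tr; move: rkB (rank_leq_row V) k_lt_N V_gt0; lia.
pose U := (x + U0)%MS; have capU : (U :&: V <= x)%MS.
  by rewrite -(matrix_modl _ (sub_orbit_mx x)) capU0 addsmx0.
exists U; first exact: addsmxSl.
move=> w stabU.
have [a xw] : exists a, x *m lin_comb C w = a *: x.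
  apply/sub_rVP; apply: submx_trans capU;
    rewrite sub_capmx -{2}mul_orbit_mx submxMl andbT.
  by apply: submx_trans stabU; apply: submxMr; apply: addsmxSl.
pose w' := w - a *: delta_mx 0 0.
have CwE : lin_comb C w = a%:M + lin_comb C w'.
  by rewrite linearB linearZ /= lin_comb_delta C0 scalemx1 addrC subrK.
have xw0 : x *m lin_comb C w' = 0.
  by move: xw; rewrite CwE mulmxDr mul_mx_scalar => /(canRL (addKr _));
    rewrite addNr.
have subV : (lin_comb C w' <= V)%MS.
  by apply/row_subP => i; rewrite rowE generic_kernel.
have Ux : (U *m lin_comb C w' <= x)%MS.
  apply: submx_trans capU;
    rewrite sub_capmx (submx_trans (submxMl _ _) subV) andbT.
  have -> : lin_comb C w' = lin_comb C w - a%:M by rewrite CwE addrC addKr.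
  by rewrite mulmxBr addmx_sub// mul_mx_scalar -scaleNr scalemx_sub.
have /submxP[z w'E] : (w' <= kermx V)%MS by apply/sub_kermxP;
  rewrite mul_orbit_mx.
have zBE q' : z *m B q' = (lin_comb C w' *m Z *m q')^T by rewrite BE -w'E.
have UG0 m (X : 'M_(N, m)) : U *m X = 0 -> G *m X = 0 -> X = 0.
  move=> UX GX; have /sub_addsmxP[[u1 u2] /= E] : (1%:M <= U + G)%MS.
    by apply: submx_trans addU0 _; rewrite addsmxS// addsmxSr.
  by rewrite -[X]mul1mx E mulmxDl -(mulmxA u1) -(mulmxA u2) UX GX !mulmx0 addr0.
have UwZ : U *m (lin_comb C w' *m Z) = 0.
  by rewrite mulmxA; apply/eqP; rewrite -submxE.
have zBq0 : z *m B q = 0.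
  apply: trmx_inj; rewrite trmx0; apply: UG0.
    by rewrite zBE trmxK mulmxA UwZ mul0mx.
  by rewrite trmx_mul mulmxA mulmx_ker mul0mx.
have GwZ : G *m (lin_comb C w' *m Z) = 0.
  apply: col_mul0 => q'; rewrite -mulmxA -[_ *m q']trmxK -zBE.
  have /submxP[D ->] : (z *m B q' <= B q)%MS.
    apply: (pencil_kernel rs_uniq _ _ zBq0) => [|t].
      by move: rkB k_lt_rs V_gt0; lia.
    suff -> : t *: B q + B q' = B (t *: q + q') by [].
    rewrite /B scalemxAr -mulmxDr; congr (_ *m _); apply/row_matrixP => i.
    by rewrite linearP /= !rowK mulmxDr -scalemxAr linearP.
  by rewrite trmx_mul mulmxA mulmx_ker mul0mx.
have /submxP[b bE] : (lin_comb C w' <= x)%MS by rewrite submxE; apply/eqP/UG0.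
exists a, b; split; first by rewrite CwE bE.
move: xw0; rewrite bE mulmxA [x *m b]mx11_scalar mul_scalar_mx => /eqP.
by rewrite scaler_eq0 (negPf x0) orbF => /eqP->; rewrite raddf0.
Qed.

(** * Rank-one elements and the trace contradiction *)

Section TraceZero.
(** The left Mathieu property as used here: if all [b *m e] are orthogonal to [C i], then
    [e *m C i = 0] since the trace form is nondegenerate. *)
Hypothesis absorbs : forall e : 'M_N, e *m e = e ->
  (forall i : 'I_k, \tr (e *m C (lift ord0 i)) = 0) ->
  forall i : 'I_k, e *m C (lift ord0 i) = 0.
Hypothesis C_neq0 : exists i : 'I_k, C (lift ord0 i) != 0.

(** Otherwise [x W] is a line, so every nonzero [y] is an eigenvector of each [C i]. Since
    [y *m C i] is also a multiple of [x], which is killed, it vanishes, and all [C (lift ord0 i)]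
    are zero. *)
Lemma generic_not_killed x : generic x ->
  exists i : 'I_k, x *m C (lift ord0 i) != 0.
Proof.
move=> gx; apply: contrapT => xC; case: C_neq0 => i /eqP; apply.
have xC0 j : x *m C (lift ord0 j) = 0.
  by apply/eqP/negPn/negP => xCj; apply: xC; exists j.
have sub_x : (orbit_mx C x <= x)%MS.
  apply/row_subP => j; rewrite rowK.
  have [j' ->|->] := unliftP ord0 j; last by rewrite C0 mulmx1.
  by rewrite xC0 sub0mx.
suff yC0 (y : 'rV_N) : y *m C (lift ord0 i) = 0.
  by apply/row_matrixP => j; rewrite rowE yC0 row0.
have [->|y0] := eqVneq y 0; first by rewrite mul0mx.
have yC_x : (y *m C (lift ord0 i) <= x)%MS.
  rewrite -lin_comb_delta; apply: submx_trans sub_x;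
    apply: generic_kernel => //.
  by rewrite lin_comb_delta.
have yC_y : (y *m C (lift ord0 i) <= y)%MS.
  have orbit_y : (orbit_mx C y <= y)%MS.
    rewrite -(geq_leqif (mxrank_leqif_sup (sub_orbit_mx y))) rank_rV y0.
    by apply: leq_trans (gx y) _;
      apply: leq_trans (mxrankS sub_x) (rank_leq_row _).
  apply: submx_trans orbit_y.
  have -> : y *m C (lift ord0 i) = row (lift ord0 i) (orbit_mx C y).
    by rewrite rowK.
  exact: row_sub.
have /sub_rVP[c yC] := yC_y; have [c0|c0] := eqVneq c 0.
  by rewrite yC c0 scale0r.
have /sub_rVP[d ->] : (y <= x)%MS.
  by rewrite -[y](scalerK c0) -yC scalemx_sub.
by rewrite -scalemxAl xC0 scaler0.
Qed.

(** If no combination without [C ord0] is [a%:M + b *m x] with [a != 0] and [x *m b = 0], those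
    stabilizing [U] are traceless on it. An orthogonal projection onto [U] then exists, and
    [absorbs] makes the [C (lift ord0 j)] kill [x], which is excluded. *)
Lemma generic_rank_one x : generic x ->
  exists (w : 'rV_k.+1) (b : 'cV_N),
    [/\ w 0 0 = 1, lin_comb C w = b *m x & x *m b = 0].
Proof.
move=> gx; have [U xU stabU] := generic_stable_subspace gx.
have [[w [a [b [w0 a0 wE xb]]]]|no_shift] :=
  pselect (exists (w : 'rV_k.+1) a (b : 'cV_N),
    [/\ w 0 0 = 0, a != 0, lin_comb C w = a%:M + b *m x & x *m b = 0]).
  exists (- a^-1 *: (w - a *: delta_mx 0 0)), (- a^-1 *: b).
  rewrite -scalemxAr xb scaler0 !mxE w0 /= sub0r mulr1 mulrNN mulVf//;
    split=> //.
  rewrite linearZ linearB linearZ /= lin_comb_delta C0 wE scalemx1.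
  by rewrite addrC addKr scalemxAl.
have [j /eqP[]] := generic_not_killed gx.
pose lift_w (w : 'rV[K]_k) : 'rV[K]_k.+1 :=
  \row_i if unlift ord0 i is Some j then w 0 j else 0.
have lift_wE w : lin_comb C (lift_w w) = lin_comb (fun j => C (lift ord0 j)) w.
  rewrite /lin_comb big_ord_recl mxE unlift_none scale0r add0r.
  by apply: eq_bigr => i _; rewrite mxE liftK.
move: (row_base U) (row_base_free U) (eq_row_base U) => B freeB BU.
have /submxP[y yE] : (x <= B)%MS by rewrite BU.
have [w D wD|R UR1 trR] :=
    @orthogonal_projection _ _ _ (fun j => C (lift ord0 j)) _ _ freeB.
  rewrite -lift_wE in wD.
  have [|a [b [wE xb]]] := stabU (lift_w w).
    by rewrite -(eqmxMr _ BU) -BU wD submxMl.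
  have a0 : a = 0.
    apply: contrapT => /eqP a0; apply: no_shift; exists (lift_w w), a, b;
      split=> //.
    by rewrite mxE unlift_none.
  (* [D] is the matrix of [b *m x] on [U]; its trace is that of [y *m B *m b = x *m b]. *)
  have -> : D = B *m b *m y.
    apply: (row_free_inj freeB).
    by rewrite -wD wE a0 raddf0 add0r -[in RHS]mulmxA -yE mulmxA.
  by rewrite mxtrace_mulC mulmxA -yE xb raddf0.
rewrite yE -mulmxA; suff -> : B *m C (lift ord0 j) = 0 by rewrite mulmx0.
rewrite -[B]mul1mx -UR1 -(mulmxA B) -(mulmxA B) (absorbs _ trR) ?mulmx0//.
by rewrite -mulmxA (mulmxA B) UR1 mul1mx.
Qed.

(** The rank-one combination kills [x], so the orbit of [x] has rank at most [k] and the scalars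
    suffice for [pencil_rank]. *)
Lemma generic_shift x (y : 'rV_N) :
  generic x -> exists t, generic (t *: x + y).
Proof.
move=> gx; have [w [b [w0 wE xb]]] := generic_rank_one gx.
have [|t rk_t] := @pencil_rank _ rs _ _ (orbit_mx C x) (orbit_mx C y) rs_uniq.
  apply: leq_trans k_lt_rs; rewrite ltn_neqAle rank_leq_row andbT.
  apply/negP => freeO; have : w *m orbit_mx C x == 0.
    by rewrite mul_orbit_mx wE mulmxA xb mul0mx.
  rewrite mulmx_free_eq0// => /eqP w00; move: w0.
  by rewrite w00 mxE => /esym/eqP; rewrite oner_eq0.
by exists t => z; apply: leq_trans (gx z) _; rewrite linearP.
Qed.

Lemma generic_basis : exists2 X : 'M_N, X \in unitmx & forall i, generic (row i
  X).
Proof.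
have [x gx] := exists_generic.
have /boolp.choice[t gt] (i : 'I_N) : exists t, generic (t *: x + row i 1%:M).
  exact: generic_shift.
pose Y := col_mx (\matrix_i (t i *: x + row i 1%:M)) x.
have fullY : row_full Y.
  rewrite -sub1mx; apply/row_subP => i;
    rewrite -(addKr (t i *: x) (row i 1%:M)).
  rewrite -scaleNr addmx_sub//.
    by apply/scalemx_sub; rewrite /Y -addsmxE addsmxSr.
  rewrite /Y -addsmxE (submx_trans _ (addsmxSl _ _))//.
  by rewrite -[X in (X <= _)%MS](rowK (fun i => t i *: x + row i 1%:M)) row_sub.
exists (rowsub (fullrankfun fullY) Y); first exact: fullrowsub_unit.
move=> i; rewrite row_rowsub; case: (split_ordP (fullrankfun fullY i)) => j ->.
  by rewrite rowKu rowK.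
by rewrite rowKd row_id.
Qed.

Lemma trace_combination_absurd (X0 : 'M_N) :
  (forall i : 'I_k, \tr (X0 *m C (lift ord0 i)) = 0) -> \tr X0 = 0.
Proof.
move=> X0C; apply: contrapT => /eqP trX0.
have trE w : \tr (X0 *m lin_comb C w) = w 0 0 * \tr X0.
  rewrite /lin_comb mulmx_sumr linear_sum big_ord_recl /= C0 -scalemxAr mulmx1.
  rewrite mxtraceZ big1 ?addr0// => i _.
  by rewrite -scalemxAr mxtraceZ X0C mulr0.
have [X unitX gX] := generic_basis.
have /choice[f fP] i : exists wb : 'rV[K]_k.+1 * 'cV[K]_N,
    [/\ wb.1 0 0 = 1, lin_comb C wb.1 = wb.2 *m row i X & row i X *m wb.2 = 0].
  by have [w [b wbP]] := generic_rank_one (gX i); exists (w, b).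
pose W := \matrix_i (f i).1; pose B := \matrix_(j, i) (f i).2 j 0.
have combE y : lin_comb C (y *m W) = B *m diag_mx y *m X.
  rewrite mulmx_sum_row linear_sum /= mul_mx_diag; apply/matrixP => i j.
  rewrite summxE !mxE; apply: eq_bigr => l _; rewrite linearZ /= rowK.
  have [_ -> _] := fP l; rewrite !mxE big_ord1 !mxE.
  by rewrite mulrA (mulrC (y 0 l)).
(* A relation [y] forces each [y_l b_l = 0]; if [b_l = 0], a zero combination has coefficient 1 on
   the identity, against [\tr X0 != 0]. *)
have freeW : row_free W.
  apply: row_free_kernel => y yW.
  have : B *m diag_mx y *m X == 0 by rewrite -combE yW linear0.
  rewrite mulmx_free_eq0 ?row_free_unit// mul_mx_diag => /eqP By0.
  apply/rowP => l; rewrite mxE; apply: contrapT => /eqP yl.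
  have b0 : (f l).2 = 0.
    apply/colP => j; move/matrixP/(_ j l): By0; rewrite !mxE => /eqP.
    by rewrite mulf_eq0 (negPf yl) orbF => /eqP.
  have [w0 wE _] := fP l; have := trE (f l).1.
  rewrite wE b0 mul0mx mulmx0 raddf0 w0 mul1r => /esym/eqP.
  by rewrite (negPf trX0).
(* [N] free rows of length [k.+1 <= N] span everything, in particular the coordinates of the
   identity. *)
have fullW : row_full W.
  by rewrite /row_full eqn_leq rank_leq_col (eqP freeW).
have /submxP[y yW] := submx_full (delta_mx 0 0 : 'rV_k.+1) fullW.
have : X *m (B *m diag_mx y) = 1%:M.
  by apply: mulmx1C; rewrite -combE -yW lin_comb_delta C0.
(* Any diagonal entry would do: it is a multiple of [x_l b_l = 0], yet equals 1. *)
move/matrixP/(_ (Ordinal k_lt_N) (Ordinal k_lt_N)); rewrite mulmxA mul_mx_diag.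
have [_ _ /matrixP/(_ 0 0)] := fP (Ordinal k_lt_N); rewrite !mxE eqxx => xb.
rewrite (_ : \sum_j _ = 0) ?mul0r; last first.
  by rewrite -[RHS]xb; apply: eq_bigr => j _; rewrite !mxE.
by move=> /esym/eqP; rewrite oner_eq0.
Qed.
End TraceZero.
End Generic.

(** * Supply of scalars and duality for subspaces *)

Lemma lt_card_seq (k : nat) (T : eqType) :
  lt_card k T -> exists2 rs : seq T, uniq rs & (k < size rs)%N.
Proof.
move=> lt_k; apply: contrapT => no_rs; apply: lt_k.
have size_rs (rs : {rs : seq T | uniq rs}) : (size (val rs) <= k)%N.
  by rewrite leqNgt; apply/negP => lt_k; apply: no_rs; exists (val rs) => //;
    apply: (valP rs).
(* A longest duplicate-free list contains every element, so [index] injects [T] into the naturals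
   below [k]. *)
have [[rs rs_uniq] /= max_rs] := bounded_max (exist (fun s => is_true (uniq s))
  [::] isT) size_rs.
have in_rs x : x \in rs.
  apply: contraT => x_rs; have xrs_uniq : uniq (x :: rs) by rewrite /= x_rs.
  by have := max_rs (exist (fun s => is_true (uniq s)) _ xrs_uniq);
    rewrite /= ltnn.
apply/pcard_leP/injfunPex; exists (index^~ rs) => [x _ /=|x y _ _].
  by apply: leq_trans (size_rs (exist (fun s => is_true (uniq s)) _ rs_uniq));
    rewrite index_mem.
by move=> /(congr1 (nth x rs)); rewrite !nth_index.
Qed.

Lemma linear_form_trace (K : fieldType) (n : nat) (f : {scalar 'M[K]_n}) :
  exists C, forall X, f X = \tr (X *m C).
Proof.
exists (\matrix_(i, j) f (delta_mx j i)) => X.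
rewrite {1}[X]matrix_sum_delta linear_sum; apply: eq_bigr => i _.
rewrite linear_sum mxE; apply: eq_bigr => j _.
by rewrite linearZ mxE.
Qed.

(** The [C i] represent the coordinates of the projection onto a complement of [M] along [M]. *)
Lemma vspace_trace_orthogonal (K : fieldType) (n : nat) (M : {vspace 'M[K]_n}) :
  exists C : 'I_(codimv M) -> 'M[K]_n,
    forall X, X \in M <-> forall i, \tr (X *m C i) = 0.
Proof.
have capU : (M^C :&: M = 0)%VS by rewrite capvC capv_compl.
have capM : (M :&: M^C = 0)%VS by rewrite capv_compl.
rewrite /codimv -dimv_compl; set U := (M^C)%VS.
have /boolp.choice[C CE] (i : 'I_(\dim U)) : exists C, forall X : 'M_n,
    coord (vbasis U) i (daddv_pi U M X) = \tr (X *m C).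
  exact: (linear_form_trace (coord (vbasis U) i \o daddv_pi U M)).
exists C => X.
have XE : daddv_pi U M X + daddv_pi M U X = X.
  by rewrite daddv_pi_add// addvC addv_complf memvf.
split=> [XM i|XC].
  move: XE; rewrite (daddv_pi_id capM XM) => /(canRL (addrK _)); rewrite subrr.
  by rewrite -CE => ->; rewrite linear0.
rewrite -XE (coord_vbasis (memv_pi U M X)) big1 ?add0r ?memv_pi// => i _.
by rewrite CE XC scale0r.
Qed.

(** * Idempotents in Mathieu subspaces *)

Section MathieuIdempotents.
Variables (K : fieldType) (A : algType K) (M : {pred A}).

Lemma idempotent_expr (e : A) m : e * e = e -> (0 < m)%N -> e ^+ m = e.
Proof. by move=> ee; elim: m => // -[|m] IHm _; rewrite ?expr1// exprS IHm. Qed.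

(** Positive powers of [e] all equal [e], so absorption for large exponents concerns [e] itself. *)
Lemma mathieu_idempotent (side : mathieu_side) (e : A) :
  mathieu_subspace side M -> e * e = e -> e \in M ->
  if side is RightM then forall c, e * c \in M else forall b, b * e \in M.
Proof.
move=> [_ absM] ee eM.
have eX m : (1 <= m)%N -> e ^+ m \in M by move=> m_gt0; rewrite idempotent_expr.
have abs1 b c := absM e b c eX.
have large (P : nat -> Prop) : (\forall m \near \oo, P m)%classic -> exists2 m,
  (0 < m)%N & P m.
  by case=> m _ Pm; exists m.+1 => //; apply: Pm => /=.
case: side absM abs1 => _ abs1.
- by move=> b; have /large[m m_gt0] := abs1 b 1; rewrite idempotent_expr.
- by move=> c; have /large[m m_gt0] := abs1 1 c; rewrite idempotent_expr.
- by move=> b; have /large[m m_gt0 [+ _]] := abs1 b 1; rewrite idempotent_expr.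
- by move=> b; have /large[m m_gt0] := abs1 b 1;
  rewrite idempotent_expr// mulr1.
Qed.

End MathieuIdempotents.

(** A rank factorization [e = L *m R] of an idempotent satisfies [R *m L = 1]. *)
Lemma mxtrace_idempotent (K : fieldType) (n : nat) (e : 'M[K]_n) :
  e *m e = e -> \tr e = (\rank e)%:R.
Proof.
move=> ee; move: (mulmx_base e) (row_base_free e) (col_base_full e).
move: (col_base e) (row_base e) => L R LR freeR fullL.
rewrite -{1}LR mxtrace_mulC; suff -> : R *m L = 1%:M by rewrite mxtrace1.
apply: (row_free_inj freeR); apply: (row_full_inj fullL).
by rewrite mul1mx -(mulmxA R) LR mulmxA LR.
Qed.

(* Write the characteristic polynomial of [X] as [q * 'X^m] with [q] coprime
   to ['X]; [u * 'X^D + v * q = 1] makes [(u * 'X^D).[X]] idempotent as soon as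
   [m <= D]. *)
Lemma fitting_idempotent (K : fieldType) (n m0 : nat) (X : 'M[K]_n.+1) :
  exists u, let e := horner_mx X (u * 'X^m0) in
    e * e = e /\ (e = 0 -> nilpotent_elt X).
Proof.
have [m [q]] := multiplicity_XsubC (char_poly X) 0.
rewrite monic_neq0 ?char_poly_monic//= subr0 => q0 charE.
have /Bezout_eq1_coprimepP[[u v] /= uv] : coprimep ('X^(m0 + m)) q.
  by rewrite coprimep_expl// coprimep_sym -['X]subr0 coprimep_XsubC.
exists (u * 'X^m); rewrite -mulrA -exprD addnC; set D := (m0 + m)%N.
have annih : horner_mx X ('X^D * q) = 0.
  by rewrite exprD -mulrA (mulrC 'X^m) -charE rmorphM /= Cayley_Hamilton mulr0.
split=> [|e0].
  apply/eqP; rewrite -subr_eq0 -rmorphM -rmorphB /=.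
  have -> : u * 'X^D * (u * 'X^D) - u * 'X^D = - (u * v) * ('X^D * q).
    by rewrite -[X in _ - X]mulr1 -mulrBr -[X in _ - X]uv opprD addrA subrr;
      ring.
  by rewrite rmorphM /= annih mulr0.
exists D; rewrite -[X in X ^+ D]horner_mx_X -rmorphXn -['X^D]mulr1 -uv /=.
have -> : 'X^D * (u * 'X^D + v * q) = u * 'X^D * 'X^D + v * ('X^D * q) by ring.
rewrite rmorphD [X in X + _]rmorphM [X in _ + X]rmorphM /= annih e0.
by rewrite mulr0 mul0r addr0.
Qed.

(** * Vanishing traces, nilpotency and two-sidedness *)

Lemma trace_eq0_of_absorbing (K : fieldType) (rs : seq K) (N k : nat)
    (C : 'I_k -> 'M[K]_N) (X : 'M_N) :
  uniq rs -> (k < size rs)%N -> (k < N)%N ->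
  (forall e : 'M_N, e *m e = e -> (forall i, \tr (e *m C i) = 0) ->
    forall i, e *m C i = 0) ->
  (exists i, C i != 0) -> (forall i, \tr (X *m C i) = 0) -> \tr X = 0.
Proof.
move=> rs_uniq k_rs k_N absC [i0 C_i0] XC.
pose C1 i := if unlift ord0 i is Some j then C j else 1%:M.
have C1_lift i : C1 (lift ord0 i) = C i by rewrite /C1 liftK.
have C10 : C1 ord0 = 1%:M by rewrite /C1 unlift_none.
apply: (trace_combination_absurd rs_uniq k_rs k_N C10).
- move=> e ee eC i; rewrite C1_lift; apply: absC => // j.
  by rewrite -C1_lift.
- by exists i0; rewrite C1_lift.
- by move=> i; rewrite C1_lift.
Qed.

Theorem theorem1p4 (K : fieldType) (n : nat) (side : mathieu_side)
    (M : {vspace 'M[K]_n.+1})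
    (M_mathieu : mathieu_subspace side M)
    (M_proper : M != fullv)
    (codim_lt_n : (codimv M < n.+1)%N)
    (codim_lt_K : lt_card (codimv M) K) :
  (forall X : 'M[K]_n.+1, X \in M -> \tr X = 0) /\
  ([pchar K] =i pred0 \/ (exists2 p : nat, p \in [pchar K] & (n.+1 <= p)%N) ->
   (forall X : 'M[K]_n.+1, radical M X -> nilpotent_elt X) /\
   mathieu_subspace TwoSidedM M).
Proof.
have [C MC] := vspace_trace_orthogonal M.
have [rs rs_uniq lt_rs] := lt_card_seq codim_lt_K.
have idemM : (forall e : 'M_n.+1, e * e = e -> e \in M -> forall b, b * e \in
  M) \/
    (forall e : 'M_n.+1, e * e = e -> e \in M -> forall c, e * c \in M).
  case: side M_mathieu => M_mathieu; [left|right|left|left] => e ee eM;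
    exact: mathieu_idempotent M_mathieu ee eM.
have C_neq0 : exists i, C i != 0.
  apply: contrapT => C0; case/eqP: M_proper; apply/vspaceP => X; rewrite memvf.
  apply/MC => i; have [->|Ci] := eqVneq (C i) 0; first by rewrite mulmx0 raddf0.
  by case: C0; exists i.
have trM (X : 'M_n.+1) : X \in M -> \tr X = 0.
  move=> /MC XC; case: idemM => absM.
    apply: (trace_eq0_of_absorbing rs_uniq lt_rs codim_lt_n _ C_neq0 XC) => e
      ee /MC eM i.
    apply: mxtrace_mull_inj => b; rewrite mulmx0 raddf0 mulmxA.
    by have /MC := absM e ee eM b; apply.
  (* Transposition reduces the right-sided case to the left-sided one. *)
  rewrite -mxtrace_tr.
  apply: (@trace_eq0_of_absorbing _ _ _ _ (fun i => (C i)^T) _ rs_uniq lt_rs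
    codim_lt_n).
  - move=> e ee eC i; apply: trmx_inj; rewrite trmx_mul trmxK trmx0.
    apply: mxtrace_mull_inj => c;
      rewrite mulmx0 raddf0 mxtrace_mulC -mulmxA mxtrace_mulC -mulmxA.
    have eTM : e^T \in M.
      by apply/MC => j; rewrite -mxtrace_tr trmx_mul trmxK mxtrace_mulC.
    have /MC/(_ i) := absM e^T (etrans (esym (trmx_mul _ _)) (congr1 trmx ee))
      eTM c.
    by rewrite -mulmxA mxtrace_mulC -mulmxA.
  - by case: C_neq0 => i Ci; exists i; rewrite trmx_eq0.
  - by move=> i; rewrite -trmx_mul mxtrace_tr mxtrace_mulC.
split=> // char_K.
have rank_eq0 (e : 'M[K]_n.+1) : e \in M -> e * e = e -> e = 0.
  move=> eM ee; apply/eqP; rewrite -mxrank_eq0; apply: contraT;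
    rewrite -lt0n => rk_gt0.
  have rk0 : (\rank e)%:R == 0 :> K by rewrite -mxtrace_idempotent// trM.
  case: char_K => [/pcharf0P char0|[p p_char n_p]].
    by move: rk_gt0; rewrite lt0n -char0 rk0.
  (* [p] divides the positive rank, which is at most [n.+1 <= p]. *)
  have rk_n : \rank e = n.+1.
    apply/eqP; rewrite eqn_leq rank_leq_row (leq_trans n_p)// dvdn_leq//.
    by rewrite (dvdn_pcharf p_char).
  have e_unit : e \in unitmx by rewrite -row_free_unit /row_free rk_n.
  have e1 : e = 1 by apply: (mulrI e_unit); rewrite ee mulr1.
  case/eqP: M_proper; apply/vspaceP => X; rewrite memvf.
  by case: idemM => /(_ e ee eM X); rewrite e1 ?mulr1 ?mul1r.
have nil_rad X : radical M X -> nilpotent_elt X.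
  case=> m0 _ XM; have [u] := fitting_idempotent m0 X; set e := horner_mx _ _.
  move=> /= [ee]; apply; apply: rank_eq0 => //.
  (* The idempotent is a combination of powers of [X] with exponents at least [m0], all in [M]. *)
  rewrite /e rmorphM rmorphXn /= horner_mx_X -[u]coefK poly_def rmorph_sum /=.
  rewrite mulr_suml; apply: memv_suml => i _.
  by rewrite linearZ rmorphXn /= horner_mx_X -scalerAl memvZ// -exprD XM//=
    leq_addl.
split=> //; split; first by case: M_mathieu.
(* Such an [a] lies in the radical, so its powers are eventually zero. *)
move=> a b c aM; have [|d ad0] := nil_rad a; first by exists 1%N => // m /aM.
exists d => // m /= d_m.
by rewrite -(subnK d_m) exprD ad0 mulr0 mulr0 mul0r mem0v.
Qed.
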